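(* Let $Y$ be a random variable whose moment generating function $E[e^{tY}]$ exists for $|t|<r_0$ for some $r_0>0$. Let $(Y_j)_{j\ge1}$ be mutually independent copies of $Y$, $S_0=0$, $S_k=Y_1+\cdots+Y_k$ for $k\ge1$. Let $r$ be a positive integer. Define $$\phi_n^Y(x)=\sum_{k=0}^{n}{n\brace k}_Y x^k,\qquad {n\brace k}_Y=\frac{1}{k!}\sum_{i=0}^{k}\binom{k}{i}(-1)^{k-i}E[S_i^n],$$ $$\phi_{n,r}^Y(x)=\sum_{k=0}^{n}{n+r\brace k+r}_{r,Y}x^k,\qquad {n+r\brace k+r}_{r,Y}=\frac{1}{k!}\sum_{j=0}^{k}\binom{k}{j}(-1)^{k-j}E\big[(S_j+r)^n\big].$$ Then for all integers $m,n\ge0$, $$\phi_{m+n,r}^Y(x)=\sum_{i=0}^{n}\sum_{k=0}^{m}\binom{n}{i}x^k\phi_i^Y(x)\frac{1}{k!}\sum_{j=k}^{m}\binom{m}{j}\sum_{l_1+\cdots+l_k=j}\binom{j}{l_1,\dots,l_k}E\Big[(S_k+r)^{n-i}\prod_{p=1}^{k}Y_p^{l_p}\Big]r^{m-j},$$ where the innermost sum runs over $k$-tuples $(l_1,\dots,l_k)$ of positive integers with sum $j$.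
   Context: $\phi_n^Y(x)$ and $\phi_{n,r}^Y(x)$ are the probabilistic Bell and probabilistic $r$-Bell polynomials associated with $Y$. For $k=0$ the sum over $(l_1,\dots,l_k)$ equals $1$ if $j=0$ and $0$ otherwise (empty product equal to $1$). $\binom{j}{l_1,\dots,l_k}$ is the multinomial coefficient. *)

(* Defs.v *)
From HB Require Import structures.
From mathcomp Require Import all_boot all_order all_algebra.
From mathcomp Require Import all_classical all_reals all_analysis.
Set Implicit Arguments. Unset Strict Implicit. Unset Printing Implicit Defensive.
Import Order.TTheory GRing.Theory Num.Theory.
Local Open Scope classical_set_scope.
Local Open Scope ring_scope.

Section Defs.
Context {d : measure_display} {T : measurableType d} {R : realType}.

Definition Ex (P : probability T R) (f : T -> R) : R := Rintegral P setT f.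

Definition mutually_independent (P : probability T R) (X : nat -> T -> R) :=
  forall (J : seq nat) (B : nat -> set R), uniq J ->
    (forall j, measurable (B j)) ->
    P (\bigcap_(j in [set` J]) (X j @^-1` B j)) =
    (\prod_(j <- J) P (X j @^-1` B j))%E.

Definition same_distribution (P : probability T R) (X Y : T -> R) :=
  forall B : set R, measurable B -> P (X @^-1` B) = P (Y @^-1` B).

Definition mgf_exists (P : probability T R) (Y : T -> R) :=
  exists2 r0 : R, 0 < r0 &
    forall t : R, `|t| < r0 -> P.-integrable setT (fun w => (expR (t * Y w))%:E).

(* The copies Y_1, Y_2, ... are X 0, X 1, ... : Y_p = X (p-1).
   S k = Y_1 + ... + Y_k, S 0 = 0. *)
Definition Ssum (X : nat -> T -> R) (k : nat) (w : T) : R := \sum_(j < k) X j w.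

Definition stirY (P : probability T R) (X : nat -> T -> R) (n k : nat) : R :=
  (k`!%:R)^-1 * \sum_(i < k.+1)
     'C(k, i)%:R * (-1) ^+ (k - i) * Ex P (fun w => Ssum X i w ^+ n).

Definition phiY (P : probability T R) (X : nat -> T -> R) (n : nat) (x : R) : R :=
  \sum_(k < n.+1) stirY P X n k * x ^+ k.

Definition rstirY (P : probability T R) (X : nat -> T -> R) (r n k : nat) : R :=
  (k`!%:R)^-1 * \sum_(j < k.+1)
     'C(k, j)%:R * (-1) ^+ (k - j) * Ex P (fun w => (Ssum X j w + r%:R) ^+ n).

Definition phirY (P : probability T R) (X : nat -> T -> R) (r n : nat) (x : R) : R :=
  \sum_(k < n.+1) rstirY P X r n k * x ^+ k.

Definition multinom (k j : nat) (l : 'I_k -> nat) : R :=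
  (j`!)%:R / (\prod_(p < k) ((l p)`!)%:R).

Definition compSum (P : probability T R) (X : nat -> T -> R) (r e k j : nat) : R :=
  \sum_(l : {ffun 'I_k -> 'I_j.+1} |
          [forall p, (0 < (l p : nat))%N] && (\sum_(p < k) (l p : nat) == j)%N)
    multinom j (fun p => l p) *
    Ex P (fun w => (Ssum X k w + r%:R) ^+ e * \prod_(p < k) X p w ^+ (l p)).

End Defs.

(* Main.v *)
(* Put G(b, t) = E[(S_b + r)^n (S_t + r)^m].  By inclusion-exclusion the sum
   over compositions is E[(S_k + r)^e sum_A (-1)^(k - |A|) (sum_{p in A} Y_p)^j],
   A ranging over the subsets of {1, ..., k}; by exchangeability only |A|
   matters, so the inner sums of the right-hand side are k-th differences of
   t |-> E[(S_k + r)^(n - i) (S_t + r)^m].  Since S_{k+s} - S_k is independent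
   of S_k and distributed as S_s, summing over i turns the right-hand side into
   sum_{k, l} x^(k + l) / (k! l!) times iterated differences of G(k + s, t) in
   s <= l and t <= k.  The coefficient of x^q is then compared with the q-th
   difference of j |-> G(j, j) through
   (z y - 1)^q = (z (y - 1) + (z - 1))^q.
   Expectations of polynomials in the Y_p depend only on the moments of Y, which
   gives both exchangeability and independence; the moments exist because
   |y|^a <= a! / t^a (e^(t y) + e^(-t y)). *)
Require Import Defs.
From HB Require Import structures.
From mathcomp Require Import all_boot all_order all_algebra.
From mathcomp Require Import all_classical all_reals all_analysis.
From mathcomp Require Import measurable_realfun ring.
Import Order.TTheory GRing.Theory Num.Theory.
Local Open Scope classical_set_scope.
Local Open Scope ring_scope.

(** * Factoring an expectation over an independent variable *)

Section Independence.
Set Implicit Arguments.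
Unset Strict Implicit.
Context {d : measure_display} {T : measurableType d} {R : realType}.
Variable P : probability T R.
Import HBNNSimple.

(** By linearity the factorization passes from indicators to simple functions, and by monotone
    convergence to the nonnegative [f] that they approximate from below. In use, [W] is the product
    of the other factors and [c] its expectation. *)
Lemma ge0_integral_mul_indep (W V : T -> R) (c : R) (f : R -> R) :
  measurable_fun setT W -> (forall w, 0 <= W w) ->
  measurable_fun setT V -> 0 <= c ->
  (forall B, measurable B ->
    (\int[P]_w (W w * \1_B (V w))%:E = c%:E * P (V @^-1` B))%E) ->
  measurable_fun setT f -> (forall y, 0 <= f y) ->
  (\int[P]_w (W w * f (V w))%:E = c%:E * \int[P]_w (f (V w))%:E)%E.
Proof.
move=> mW W0 mV c0 WV mf f0.
have mEf : measurable_fun [set: R] (fun y : R => (f y)%:E) by exact/measurable_EFinP.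
pose h := nnsfun_approx measurableT mEf.
have hf y : (h n y)%:E @[n --> \oo] --> (f y)%:E.
  by apply: cvg_nnsfun_approx => // z _; rewrite lee_fin.
have mhV n : measurable_fun setT (h n \o V).
  exact: measurableT_comp.
have ndh y : {homo (h ^~ y) : a b / (a <= b)%N >-> a <= b}.
  by move=> a b ab; exact/lefP/nd_nnsfun_approx.
have h0 n y w : 0 <= y * \1_(h n @^-1` [set y]) (V w).
  by rewrite -lee_fin EFinM nnfun_muleindic_ge0.
have step n : (\int[P]_w (W w * h n (V w))%:E = c%:E * \int[P]_w (h n (V w))%:E)%E.
  under eq_integral do rewrite fimfunE fsbig_finite//= mulr_sumr -sumEFin.
  rewrite ge0_integral_sum//; last 2 first.
  - move=> y; apply/measurable_EFinP; apply: measurable_funM => //.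
    apply: measurable_funM => //.
    by apply: (measurableT_comp _ mV); exact: measurable_indic.
  - by move=> y w _; rewrite lee_fin mulr_ge0.
  under [in RHS]eq_integral do rewrite fimfunE fsbig_finite//= -sumEFin.
  rewrite ge0_integral_sum//; last 2 first.
  - move=> y; apply/measurable_EFinP; apply: measurable_funM => //.
    by apply: (measurableT_comp _ mV); exact: measurable_indic.
  - by move=> y w _; rewrite lee_fin.
  rewrite ge0_sume_distrr; last first.
    by move=> y _; apply: integral_ge0 => w _; rewrite lee_fin.
  apply: eq_bigr => y _.
  have mB : measurable (h n @^-1` [set y]) by [].
  (* The scalar [y] leaves an integral only if it is nonnegative; a negative value is never taken by
     [h n], so both sides are then zero. *)
  have [y0|y0] := ltP y 0.
    rewrite preimage_nnfun0//.
    under eq_integral do rewrite indic0 !mulr0.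
    under [in RHS]eq_integral do rewrite indic0 !mulr0.
    by rewrite !integral0 mule0.
  under eq_integral do rewrite mulrCA EFinM.
  rewrite ge0_integralZl_EFin//; last 2 first.
  - by move=> w _; rewrite lee_fin mulr_ge0.
  - apply/measurable_EFinP; apply: measurable_funM => //.
    by apply: (measurableT_comp _ mV); exact: measurable_indic.
  rewrite WV//.
  under [in RHS]eq_integral do rewrite EFinM.
  rewrite ge0_integralZl_EFin//; last first.
  - apply/measurable_EFinP.
    by apply: (measurableT_comp _ mV); exact: measurable_indic.
  rewrite muleCA; congr (_ * (_ * _))%E.
  rewrite [RHS](_ : _ = \int[P]_w (\1_(V @^-1` (h n @^-1` [set y])) w)%:E)%E//.
  rewrite integral_indic ?setIT//.
  by rewrite -(setTI (_ @^-1` _)); exact: mV.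
transitivity (limn (fun n => \int[P]_w (W w * h n (V w))%:E))%E.
  rewrite -monotone_convergence//.
  - apply: eq_integral => w _; apply/esym/cvg_lim => //.
    by under eq_fun do rewrite EFinM; rewrite EFinM; apply: cvgeZl.
  - move=> n; apply/measurable_EFinP; exact: (measurable_funM mW (mhV n)).
  - by move=> n w _; rewrite lee_fin mulr_ge0.
  - by move=> w _ a b ab; rewrite lee_fin ler_wpM2l// ndh.
under eq_fun do rewrite step.
apply/cvg_lim => //; apply: cvgeZl => //.
rewrite [X in _ --> X](_ : _ = \int[P]_w limn (fun n => (h n (V w))%:E))%E; last first.
  by apply: eq_integral => w _; apply/esym/cvg_lim.
apply: cvg_monotone_convergence => //.
- by move=> n; apply/measurable_EFinP; exact: (mhV n).
- by move=> n w _; rewrite lee_fin.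
- by move=> w _ a b ab; rewrite lee_fin ndh.
Qed.
End Independence.

(** * Expectations of products of functions of independent variables *)

Section Expectation.
Set Implicit Arguments.
Unset Strict Implicit.
Context {d : measure_display} {T : measurableType d} {R : realType}.
Variable P : probability T R.

Definition integ (f : T -> R) := P.-integrable setT (fun w => (f w)%:E).

Lemma ExE (f : T -> R) : integ f -> (\int[P]_w (f w)%:E = (Ex P f)%:E)%E.
Proof. by move=> fi; rewrite /Ex /Rintegral fineK//; exact: integrable_fin_num. Qed.

Lemma ExD (f g : T -> R) : integ f -> integ g ->
  Ex P (fun w => f w + g w) = Ex P f + Ex P g.
Proof. by move=> fi gi; rewrite /Ex RintegralD. Qed.

Lemma integD (f g : T -> R) : integ f -> integ g -> integ (fun w => f w + g w).
Proof. by move=> fi gi; exact: (integrableD measurableT fi gi). Qed.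

Lemma integZ (c : R) (f : T -> R) : integ f -> integ (fun w => c * f w).
Proof. by move=> fi; exact: (integrableZl measurableT _ fi). Qed.

Lemma ExZ (c : R) (f : T -> R) : integ f -> Ex P (fun w => c * f w) = c * Ex P f.
Proof. by move=> fi; rewrite /Ex RintegralZl. Qed.

Lemma integ0 : integ (fun=> 0).
Proof. exact: integrable0. Qed.

Lemma integ_sum (I : eqType) (s : seq I) (Q : pred I) (F : I -> T -> R) :
  (forall i, i \in s -> Q i -> integ (F i)) -> integ (fun w => \sum_(i <- s | Q i) F i w).
Proof.
elim: s => [|i s IH] H.
  by rewrite (_ : (fun _ => _) = fun=> 0); [exact: integ0|apply/funext => w; rewrite big_nil].
have Hs j : j \in s -> Q j -> integ (F j) by move=> js; apply: H; rewrite inE js orbT.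
under eq_fun do rewrite big_cons.
have := H i (mem_head _ _); case: (Q i) => Hi; last exact: IH.
by apply: integD; [exact: Hi|exact: IH].
Qed.

Lemma Ex_sum (I : eqType) (s : seq I) (Q : pred I) (F : I -> T -> R) :
  (forall i, i \in s -> Q i -> integ (F i)) ->
  Ex P (fun w => \sum_(i <- s | Q i) F i w) = \sum_(i <- s | Q i) Ex P (F i).
Proof.
elim: s => [|i s IH] H.
  rewrite big_nil (_ : (fun _ => _) = fun=> 0).
    by rewrite /Ex /Rintegral integral0.
  by apply/funext => w; rewrite big_nil.
have Hs j : j \in s -> Q j -> integ (F j) by move=> js; apply: H; rewrite inE js orbT.
under eq_fun do rewrite big_cons.
rewrite big_cons; have := H i (mem_head _ _).
case: (Q i) => Hi; last exact: IH.
by rewrite (ExD (Hi isT)) ?IH//; exact: integ_sum.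
Qed.

Lemma ge0_integ (f : T -> R) (c : R) : measurable_fun setT f -> (forall w, 0 <= f w) ->
  (\int[P]_w (f w)%:E = c%:E)%E -> integ f /\ Ex P f = c.
Proof.
move=> mf f0 fc; split; last by rewrite /Ex /Rintegral fc.
apply/integrableP; split; first exact/measurable_EFinP.
by under eq_integral do rewrite /= ger0_norm//; rewrite fc ltry.
Qed.

Lemma Ex_indic (A : set T) : measurable A -> integ \1_A /\ Ex P \1_A = fine (P A).
Proof.
move=> mA; apply: ge0_integ => //.
by rewrite integral_indic// setIT fineK// fin_num_measure.
Qed.

Lemma Ex_cst (c : R) : integ (fun=> c) /\ Ex P (fun=> c) = c.
Proof.
split; first exact: finite_measure_integrable_cst.
by rewrite /Ex Rintegral_cst// [X in fine X](probability_setT P) mulr1.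
Qed.

Lemma le_integ (f g : T -> R) : measurable_fun setT f -> integ g ->
  (forall w, `|f w| <= g w) -> integ f.
Proof.
move=> mf gi fg; apply: (le_integrable measurableT _ _ gi).
  exact/measurable_EFinP.
by move=> w _ /=; rewrite lee_fin (le_trans (fg w))// ler_norm.
Qed.

Variable X : nat -> T -> R.
Hypothesis mX : forall j, measurable_fun setT (X j).
Hypothesis indX : mutually_independent P X.

(** Induction on [q], the number of leading factors that may be arbitrary, the later ones being
    indicators. For [q = 0] this is mutual independence itself; each step frees one more factor. *)
Lemma ge0_Ex_prod (N q : nat) (f : nat -> R -> R) : (q <= N)%N ->
  (forall p, measurable_fun setT (f p)) -> (forall p y, 0 <= f p y) ->
  (forall p, integ (fun w => f p (X p w))) ->
  (forall p, (q <= p)%N -> exists2 B : set R, measurable B & f p = \1_B) ->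
  (\int[P]_w (\prod_(p < N) f p (X p w))%:E = (\prod_(p < N) Ex P (fun w => f p (X p w)))%:E)%E.
Proof.
have mXB p (B : set R) : measurable B -> measurable (X p @^-1` B).
  by move=> mB; rewrite -[_ @^-1` _]setTI; exact: mX.
elim: q f => [|q IH] f qN mf f0 fi fB.
  have /choice[B HB] : forall p, exists B : set R, measurable B /\ f p = \1_B.
    by move=> p; have [//|B ? ?] := fB p; exists B.
  have mB p := (HB p).1; have {HB}fE p := (HB p).2.
  transitivity (P (\bigcap_(j in [set` iota 0 N]) (X j @^-1` B j))).
    rewrite (_ : (fun w => _) = fun w => (\1_(\bigcap_(j in [set` iota 0 N]) (X j @^-1` B j)) w)%:E).
      rewrite integral_indic ?setIT//; apply: fin_bigcap_measurable => // j _.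
      exact: mXB.
    apply/funext => w; congr (_ %:E); rewrite indicE.
    have [wB|wB] := boolP (w \in _).
      rewrite big1// => p _; rewrite fE indicE mem_set//.
      by move: wB; rewrite inE; apply; rewrite /= mem_iota/=.
    apply/eqP/prodf_eq0.
    have : ~ (\bigcap_(j in [set` iota 0 N]) (X j @^-1` B j)) w by move=> /mem_set; exact/negP.
    rewrite -existsNP => -[j]; rewrite not_implyE => -[/= + jB].
    rewrite mem_iota/= add0n => jN; exists (Ordinal jN) => //=.
    by rewrite fE indicE memNset.
  rewrite indX ?iota_uniq// (_ : iota 0 N = index_iota 0 N); last first.
    by rewrite /index_iota subn0.
  rewrite big_mkord -prodEFin.
  apply: eq_bigr => p _; rewrite fE.
  have /= -> := (Ex_indic (mXB p _ (mB p))).2.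
  by rewrite fineK// fin_num_measure//; exact: mXB.
pose oq := Ordinal qN.
(* Isolate factor [q]: the others play the role of [W], and [X q] that of [V]. *)
under eq_integral do rewrite (bigD1 oq)//= mulrC.
rewrite (bigD1 oq)//= EFinM muleC -(ExE (fi q)).
apply: ge0_integral_mul_indep => //.
- under eq_fun do rewrite big_mkcond/=.
  apply: measurable_prod => p _; case: (p != oq) => //.
  exact: measurableT_comp.
- by move=> w; apply: prodr_ge0.
- by apply: prodr_ge0 => p _; apply: Rintegral_ge0.
(* With an indicator in position [q], the induction hypothesis applies and gives the factorization
   over events of [X q]. *)
- move=> B mB; pose f' p := if p == q then \1_B else f p.
  have f'E (p : 'I_N) : p != oq -> f' p = f p.
    by rewrite /f' -(inj_eq val_inj)/= => /negbTE ->.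
  have f'q : f' q = \1_B by rewrite /f' eqxx.
  have f'i p : integ (fun w => f' p (X p w)).
    rewrite /f'; case: (p == q); last exact: fi.
    exact: (Ex_indic (mXB p _ mB)).1.
  transitivity (\int[P]_w (\prod_(p < N) f' p (X p w))%:E)%E.
    apply: eq_integral => w _; congr (_ %:E).
    rewrite [RHS](bigD1 oq)//= f'q mulrC; congr (_ * _).
    by apply: eq_bigr => p pq; rewrite f'E.
  rewrite IH//; [|exact: ltnW|..].
  - rewrite (bigD1 oq)//= EFinM muleC f'q.
    have /= -> := (Ex_indic (mXB q _ mB)).2.
    rewrite fineK ?fin_num_measure//; last exact: mXB.
    congr (_ %:E * _)%E.
    by apply: eq_bigr => p pq; rewrite f'E.
  - move=> p; rewrite /f'; case: (p == q) => //; exact: measurable_indic.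
  - by move=> p y; rewrite /f'; case: (p == q).
  - move=> p; rewrite leq_eqVlt => /predU1P[<-|qp]; first by exists B.
    by rewrite /f' gtn_eqF//; exact: fB.
Qed.

(** Each factor is split into its positive and negative parts, and the product is expanded over all
    choices of signs, so that the nonnegative case applies to each term. *)
Lemma Ex_prod (N : nat) (f : nat -> R -> R) :
  (forall p, measurable_fun setT (f p)) ->
  (forall p, integ (fun w => f p (X p w))) ->
  integ (fun w => \prod_(p < N) f p (X p w)) /\
  Ex P (fun w => \prod_(p < N) f p (X p w)) = \prod_(p < N) Ex P (fun w => f p (X p w)).
Proof.
move=> mf fi.
(* [g false] is the positive part and [g true] the negative part. *)
pose g (b : bool) (p : nat) (y : R) := Num.max ((-1) ^+ b * f p y) 0.
have fE p y : f p y = \sum_(b : bool) (-1) ^+ b * g b p y.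
  rewrite big_bool /g/= expr1 expr0 !mul1r !mulN1r; have [f0|f0] := leP 0 (f p y).
    by rewrite (@max_r _ _ (- f p y)) ?oppr_le0// oppr0 add0r.
  by rewrite (@max_l _ _ (- f p y)) ?oppr_ge0 ?ltW// opprK addr0.
have mg b p : measurable_fun setT (g b p).
  by apply: measurable_maxr => //; apply: measurable_funM.
have g0 b p y : 0 <= g b p y by rewrite le_max lexx orbT.
have gi b p : integ (fun w => g b p (X p w)).
  apply: (@le_integ _ (fun w => `|f p (X p w)|)).
  - exact: measurableT_comp.
  - exact: (integrable_norm (fi p)).
  - move=> w; rewrite ger0_norm// /g ge_max normr_ge0 andbT.
    by rewrite (le_trans (ler_norm _))// normrM normrX normrN1 expr1n mul1r.
have gP (e : {ffun 'I_N -> bool}) :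
    integ (fun w => \prod_(p < N) g (e p) p (X p w)) /\
    Ex P (fun w => \prod_(p < N) g (e p) p (X p w)) = \prod_(p < N) Ex P (fun w => g (e p) p (X p w)).
  (* Extends the family to all indices; the default [cst 0] is the indicator of the empty set, as
     [ge0_Ex_prod] demands from [N] on. *)
  pose h (p : nat) := if insub p is Some o then g (e o) p else cst 0.
  have hE (p : 'I_N) : h p = g (e p) p by rewrite /h valK.
  have H0 p y : 0 <= h p y by rewrite /h; case: insub.
  have Hm p : measurable_fun setT (h p) by rewrite /h; case: insub.
  have Hi p : integ (fun w => h p (X p w)).
    by rewrite /h; case: insub => [u|]; [exact: gi|exact: integ0].
  under eq_fun do under eq_bigr do rewrite -hE.
  under [in RHS]eq_bigr do rewrite -hE.
  apply: ge0_integ.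
  - by apply: measurable_prod => p _; exact: measurableT_comp.
  - by move=> w; apply: prodr_ge0.
  - apply: (@ge0_Ex_prod N N) => // p Np; exists set0 => //.
    by rewrite /h insubF ?ltnNge ?Np// indic0.
have fPE w : \prod_(p < N) f p (X p w) =
    \sum_(e : {ffun 'I_N -> bool}) (\prod_(p < N) (-1) ^+ e p) * \prod_(p < N) g (e p) p (X p w).
  under eq_bigr do rewrite fE.
  by rewrite bigA_distr_bigA; apply: eq_bigr => e _; rewrite big_split.
under eq_fun do rewrite fPE.
split; first by apply: integ_sum => e _ _; apply: integZ; exact: (gP e).1.
rewrite Ex_sum; last by move=> e _ _; apply: integZ; exact: (gP e).1.
transitivity (\prod_(p < N) \sum_(b : bool) (-1) ^+ b * Ex P (fun w => g b p (X p w))).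
  rewrite bigA_distr_bigA; apply: eq_bigr => e _.
  by rewrite ExZ ?(gP e).2 ?big_split//; exact: (gP e).1.
apply: eq_bigr => p _.
under [in RHS]eq_fun do rewrite fE.
rewrite Ex_sum => [|b _ _]; last exact: integZ.
by apply: eq_bigr => b _; rewrite ExZ.
Qed.
End Expectation.

(** * Existence of moments and their transfer between equidistributed variables *)

Section Moments.
Set Implicit Arguments.
Unset Strict Implicit.
Context {d : measure_display} {T : measurableType d} {R : realType}.
Variable P : probability T R.

(** One term of the exponential series at [t * |y|] is at most its sum, and [expR (t * |y|)] is one
    of the two exponentials on the right. *)
Lemma normr_expn_le_expR (t y : R) (a : nat) : 0 < t ->
  `|y ^+ a| <= a`!%:R / t ^+ a * (expR (t * y) + expR (- t * y)).
Proof.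
move=> t0; have Ey : expR (t * `|y|) <= expR (t * y) + expR (- t * y).
  have [y0|y0] := leP 0 y.
    by rewrite ger0_norm// lerDl expR_ge0.
  by rewrite ltr0_norm// mulrN mulNr lerDr expR_ge0.
have ta : 0 <= a`!%:R / t ^+ a by rewrite divr_ge0// exprn_ge0// ltW.
apply: le_trans (ler_wpM2l ta Ey).
rewrite normrX mulrAC ler_pdivlMr ?exprn_gt0// -exprMn.
rewrite -ler_pdivrMl ?ltr0n ?fact_gt0// mulrC [`|y| * t]mulrC.
have ty : 0 <= t * `|y| by rewrite mulr_ge0// ltW.
(* The series bound has the form [1 + x ^+ a / a!] with [a] positive, so the zeroth power is treated
   apart. *)
case: a {ta} => [|a]; last by apply: le_trans (expR_ge1Dxn a ty); rewrite lerDr.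
by rewrite expr0 fact0 divr1 -expR0 ler_expR.
Qed.

Lemma mgf_exists_moment (Y : T -> R) (a : nat) :
  measurable_fun setT Y -> mgf_exists P Y -> integ P (fun w => Y w ^+ a).
Proof.
move=> mY [r0 r00 Hr]; have t0 : 0 < r0 / 2 by rewrite divr_gt0.
have tr : r0 / 2 < r0 by rewrite ltr_pdivrMr// ltr_pMr// ltr1n.
apply: le_integ (fun w => normr_expn_le_expR (Y w) a t0).
  exact: measurable_funX.
apply: integZ; apply: integD; apply: Hr; first by rewrite gtr0_norm.
by rewrite normrN gtr0_norm.
Qed.

(** Both expectations are integrals of [f] against the image measures, which agree on measurable
    sets; integrability is transferred first, through the absolute value. *)
Lemma same_distribution_Ex (X Y : {RV P >-> R}) (f : R -> R) :
  same_distribution P X Y -> measurable_fun setT f ->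
  integ P (fun w => f (Y w)) ->
  integ P (fun w => f (X w)) /\ Ex P (fun w => f (X w)) = Ex P (fun w => f (Y w)).
Proof.
move=> XY mf fY.
have mEf : measurable_fun setT (fun y => (f y)%:E) by exact/measurable_EFinP.
have XYE (g : R -> \bar R) : (\int[distribution P X]_y g y = \int[distribution P Y]_y g y)%E.
  by apply: eq_measure_integral => A mA _; exact: XY.
have fX : integ P (fun w => f (X w)).
  apply/integrableP; split; first by apply/measurable_EFinP; exact: measurableT_comp.
  have := ge0_integral_distribution X (measurableT_comp (@abse_measurable R setT) mEf).
  move=> /(_ (fun y => abse_ge0 _)) /= <-.
  rewrite XYE ge0_integral_distribution//.
    by case/integrableP: fY.
  by apply/measurable_EFinP; exact: measurableT_comp.
split => //; apply: EFin_inj; rewrite -!ExE//.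
by rewrite -(integral_distribution mEf fX) -(integral_distribution mEf fY) XYE.
Qed.

End Moments.

(** * Expectations of polynomials in independent variables with common moments *)

Section PolynomialExpectation.
Set Implicit Arguments.
Unset Strict Implicit.
Context {d : measure_display} {T : measurableType d} {R : realType}.
Variable P : probability T R.
Variable mu : nat -> R.

(** Equality of laws is recorded only through the moments [mu], which determine, with independence,
    the expectation of every polynomial in the variables. *)
Definition iid_moments (X : nat -> T -> R) :=
  [/\ forall j, measurable_fun setT (X j), mutually_independent P X &
      forall j a, integ P (fun w => X j w ^+ a) /\ Ex P (fun w => X j w ^+ a) = mu a].

Lemma iid_moments_comp (X : nat -> T -> R) (s : nat -> nat) :
  injective s -> iid_moments X -> iid_moments (X \o s).
Proof.
move=> s_inj [mX iX EX]; split => [j||j a]; [exact: mX| |exact: EX].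
(* [B'] carries the events along [s]; outside the image of [J] it takes the value [B 0], which is
   still measurable. *)
move=> J B uJ mB; pose B' i := B (nth 0%N J (index i (map s J))).
have BE j : j \in J -> B' (s j) = B j.
  by move=> jJ; rewrite /B' (index_map s_inj) nth_index.
rewrite (_ : \bigcap_(j in _) _ = \bigcap_(i in [set` map s J]) (X i @^-1` B' i)).
  rewrite iX ?map_inj_uniq//; last by move=> j; exact: mB.
  rewrite big_map [LHS]big_seq [RHS]big_seq.
  by apply: eq_bigr => j jJ; rewrite BE.
apply/seteqP; split => w /= H.
  by move=> _ /mapP[j jJ ->]; rewrite /= BE//; exact: H.
by move=> j jJ; rewrite -(BE j jJ); apply: H; exact: map_f.
Qed.

Lemma Ex_monomial (X : nat -> T -> R) (N : nat) (a : nat -> nat) : iid_moments X ->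
  integ P (fun w => \prod_(p < N) X p w ^+ a p) /\
  Ex P (fun w => \prod_(p < N) X p w ^+ a p) = \prod_(p < N) mu (a p).
Proof.
move=> [mX iX EX].
have mf p : measurable_fun setT (fun y : R => y ^+ a p) by exact: measurable_funX.
have [fi fE] := Ex_prod mX iX N mf (fun p => (EX p (a p)).1).
by split => //; rewrite fE; apply: eq_bigr => p _; exact: (EX p _).2.
Qed.

(** [F] acts on whole sequences rather than on [N]-tuples, so that it can be evaluated at reindexed
    and shifted families; the expectation is read off the list of monomials. *)
Definition polyfun (N : nat) (F : (nat -> R) -> R) :=
  exists s : seq (R * (nat -> nat)),
    forall v, F v = \sum_(t <- s) t.1 * \prod_(p < N) v p ^+ t.2 p.

Lemma polyfun_cst N (c : R) : polyfun N (fun=> c).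
Proof.
by exists [:: (c, fun=> 0%N)] => v; rewrite big_seq1 big1 ?mulr1.
Qed.

Lemma polyfun_coord N p : (p < N)%N -> polyfun N (fun v => v p).
Proof.
move=> pN; exists [:: (1, fun q => (q == p) : nat)] => v.
rewrite big_seq1 mul1r (bigD1 (Ordinal pN))//= eqxx expr1 big1 ?mulr1// => q qp.
by rewrite -(inj_eq val_inj)/= in qp; rewrite (negbTE qp) expr0.
Qed.

Lemma polyfunD N F G : polyfun N F -> polyfun N G -> polyfun N (fun v => F v + G v).
Proof. by move=> [s Fs] [u Gu]; exists (s ++ u) => v; rewrite Fs Gu big_cat. Qed.

Lemma polyfunM N F G : polyfun N F -> polyfun N G -> polyfun N (fun v => F v * G v).
Proof.
move=> [s Fs] [u Gu].
exists [seq (t.1 * t'.1, fun p => (t.2 p + t'.2 p)%N) | t <- s, t' <- u] => v.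
rewrite Fs Gu big_allpairs_dep/= mulr_suml; apply: eq_bigr => t _.
rewrite mulr_sumr; apply: eq_bigr => t' _.
rewrite mulrACA -big_split/=; congr (_ * _).
by apply: eq_bigr => p _; rewrite exprD.
Qed.

Lemma polyfunX N F n : polyfun N F -> polyfun N (fun v => F v ^+ n).
Proof.
move=> FN; elim: n => [|n IH]; first exact: polyfun_cst.
by under eq_fun do rewrite exprS; exact: polyfunM.
Qed.

Lemma polyfun_sum N (I : Type) (s : seq I) (Q : pred I) (F : I -> (nat -> R) -> R) :
  (forall i, polyfun N (F i)) -> polyfun N (fun v => \sum_(i <- s | Q i) F i v).
Proof.
move=> FN; elim: s => [|i s IH].
  by under eq_fun do rewrite big_nil; exact: polyfun_cst.
under eq_fun do rewrite big_cons.
by case: (Q i) => //; exact: polyfunD.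
Qed.

Lemma polyfun_prod N (I : Type) (s : seq I) (F : I -> (nat -> R) -> R) :
  (forall i, polyfun N (F i)) -> polyfun N (fun v => \prod_(i <- s) F i v).
Proof.
move=> FN; elim: s => [|i s IH].
  by under eq_fun do rewrite big_nil; exact: polyfun_cst.
by under eq_fun do rewrite big_cons; exact: polyfunM.
Qed.

Lemma polyfun_psum N k : (k <= N)%N -> polyfun N (fun v => \sum_(p < k) v p).
Proof.
move=> kN; apply: polyfun_sum => p; apply: polyfun_coord.
exact: leq_trans (ltn_ord p) kN.
Qed.

Lemma polyfun_Ex N (F : (nat -> R) -> R) (X : nat -> T -> R) (s : seq (R * (nat -> nat))) : iid_moments X ->
  (forall v, F v = \sum_(t <- s) t.1 * \prod_(p < N) v p ^+ t.2 p) ->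
  integ P (fun w => F (X ^~ w)) /\
  Ex P (fun w => F (X ^~ w)) = \sum_(t <- s) t.1 * \prod_(p < N) mu (t.2 p).
Proof.
move=> iX Fs; under eq_fun do rewrite Fs.
have ti (t : R * (nat -> nat)) := Ex_monomial N t.2 iX.
elim: s {Fs} => [|t s [IH1 IH2]].
  rewrite big_nil; under eq_fun do rewrite big_nil.
  by have [? ?] := Ex_cst P 0.
rewrite big_cons; under eq_fun do rewrite big_cons.
have ci := integZ t.1 (ti t).1; split; first exact: integD.
by rewrite ExD// IH2 ExZ ?(ti t).2//; exact: (ti t).1.
Qed.

Lemma polyfun_integ N F (X : nat -> T -> R) : iid_moments X -> polyfun N F ->
  integ P (fun w => F (X ^~ w)).
Proof. by move=> iX [s Fs]; exact: (polyfun_Ex iX Fs).1. Qed.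

(** Both sides are the same expression in [mu]. With a reindexing of [X] as [X'], this is
    exchangeability. *)
Lemma polyfun_exchangeable N F (X X' : nat -> T -> R) :
  iid_moments X -> iid_moments X' -> polyfun N F ->
  Ex P (fun w => F (X ^~ w)) = Ex P (fun w => F (X' ^~ w)).
Proof. by move=> iX iX' [s Fs]; rewrite (polyfun_Ex iX Fs).2 (polyfun_Ex iX' Fs).2. Qed.

(** [F] and the shifted [G] read disjoint blocks of variables, so the moment product of each
    monomial splits; the shifted block has the same moments as the first [M] variables. *)
Lemma polyfun_indep N M F G (X : nat -> T -> R) :
  iid_moments X -> polyfun N F -> polyfun M G ->
  Ex P (fun w => F (X ^~ w) * G (fun p => X (N + p)%N w)) =
  Ex P (fun w => F (X ^~ w)) * Ex P (fun w => G (X ^~ w)).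
Proof.
move=> iX [s Fs] [u Gu]; rewrite (polyfun_Ex iX Fs).2 (polyfun_Ex iX Gu).2.
pose H v := F v * G (fun p => v (N + p)%N).
(* Concatenation of the two exponent vectors. *)
pose cc (t t' : R * (nat -> nat)) p := if (p < N)%N then t.2 p else t'.2 (p - N)%N.
have HE v : H v = \sum_(z <- [seq (t.1 * t'.1, cc t t') | t <- s, t' <- u])
    z.1 * \prod_(p < N + M) v p ^+ z.2 p.
  rewrite /H Fs Gu big_allpairs_dep/= mulr_suml; apply: eq_bigr => t _.
  rewrite mulr_sumr; apply: eq_bigr => t' _.
  rewrite mulrACA big_split_ord/=; congr (_ * (_ * _)); apply: eq_bigr => p _.
    by rewrite /cc ltn_ord.
  by rewrite /cc ltnNge leq_addr/= addKn.
rewrite (polyfun_Ex iX HE).2 big_allpairs_dep/= mulr_suml; apply: eq_bigr => t _.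
rewrite mulr_sumr; apply: eq_bigr => t' _.
rewrite big_split_ord/= [RHS]mulrACA; congr (_ * (_ * _)); apply: eq_bigr => p _.
  by rewrite /cc ltn_ord.
by rewrite /cc ltnNge leq_addr/= addKn.
Qed.

End PolynomialExpectation.

(** * From compositions to alternating sums over subsets *)

Section InclusionExclusion.
Set Implicit Arguments.
Unset Strict Implicit.
Context {R : realType}.

Definition trunc_exp (j : nat) (y : R) : {poly R} :=
  \poly_(a < j.+1) (y ^+ a / a`!%:R).

(** Truncation does not affect the degrees up to [j], where the product of exponentials is the
    exponential of the sum; the induction step is the binomial theorem. *)
Lemma coef_prod_trunc_exp (I : Type) (s : seq I) (Q : pred I) (j i : nat) (u : I -> R) :
  (i <= j)%N ->
  (\prod_(p <- s | Q p) trunc_exp j (u p))`_i = (\sum_(p <- s | Q p) u p) ^+ i / i`!%:R.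
Proof.
elim: s i => [|p s IH] i ij.
  rewrite !big_nil coef1 expr0n; case: i {ij} => [|i]; last by rewrite mul0r.
  by rewrite fact0 divr1.
rewrite !big_cons; case: (Q p); last exact: IH.
rewrite coefM addrC exprDn mulr_suml; apply: eq_bigr => /= -[a ai] _ /=.
have aj : (a <= i)%N by rewrite -ltnS.
rewrite coef_poly ltnS (leq_trans aj ij) IH ?(leq_trans _ ij) ?leq_subr//.
rewrite -(bin_fact aj) !natrM -mulr_natr.
have f0 n : n`!%:R != 0 :> R by rewrite pnatr_eq0 -lt0n fact_gt0.
have b0 : 'C(i, a)%:R != 0 :> R by rewrite pnatr_eq0 -lt0n bin_gt0.
by field; rewrite b0 !f0.
Qed.

(* Both sides are [j`!] times the coefficient of ['X^j] in
   [\prod_p (exp (u p * 'X) - 1)], the exponentials being truncated. *)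
Lemma sum_compositions_incl_excl (k j : nat) (u : 'I_k -> R) :
  \sum_(l : {ffun 'I_k -> 'I_j.+1} |
         [forall p, (0 < (l p : nat))%N] && (\sum_(p < k) (l p : nat) == j)%N)
     multinom j (fun p => l p) * \prod_(p < k) u p ^+ l p =
  \sum_(A : {set 'I_k}) (-1) ^+ (k - #|A|) * (\sum_(p in A) u p) ^+ j.
Proof.
have fj0 : j`!%:R != 0 :> R by rewrite pnatr_eq0 -lt0n fact_gt0.
apply: (mulIf (invr_neq0 fj0)).
transitivity (\prod_(p < k) (trunc_exp j (u p) - 1))`_j; last first.
  (* [A] is the set of factors from which the exponential is chosen; the others contribute [-1]. *)
  rewrite bigA_distr coef_sum mulr_suml; apply: eq_bigr => A _.
  rewrite (bigID (mem A))/= (eq_bigr (fun p => trunc_exp j (u p))); last by move=> p ->.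
  rewrite [X in _ * X](eq_bigr (fun=> (-1)%:P)); last first.
    by move=> p /negbTE ->; rewrite polyCN.
  rewrite -[X in _ * X]rmorph_prod/= coefMC coef_prod_trunc_exp// mulrC mulrA.
  congr (_ * _ * _).
  rewrite (eq_bigl (mem (~: A))); last by move=> p; rewrite !inE.
  by rewrite prodr_const cardsCs finset.setCK card_ord.
(* Subtracting 1 removes the constant term, which is what forces the parts of the composition to be
   positive. *)
have expE y : trunc_exp j y - 1 =
    \sum_(a < j.+1) (if (0 < a)%N then (y ^+ a / a`!%:R)%:P * 'X^a else 0).
  rewrite /trunc_exp poly_def !big_ord_recl/= expr0 fact0 divr1 expr0 scale1r.
  rewrite add0r addrAC subrr add0r.
  by apply: eq_bigr => a _; rewrite -mul_polyC.
under [in RHS]eq_bigr do rewrite expE.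
rewrite bigA_distr_bigA coef_sum mulr_suml big_mkcond; apply: eq_bigr => l _ /=.
have [/forallP l0|] := boolP [forall p, (0 < (l p : nat))%N] => /=; last first.
  rewrite negb_forall => /existsP[p /negbTE lp].
  by rewrite (bigD1 p)//= lp mul0r coef0.
under [in RHS]eq_bigr do rewrite l0.
rewrite big_split/= -rmorph_prod/= prodrXr coefCM coefXn eq_sym.
case: eqP => _; last by rewrite mulr0.
rewrite mulr1 /multinom mulrAC [j`!%:R / _ / _]mulrAC mulfV// mul1r mulrC.
by rewrite [RHS]big_split/= prodfV.
Qed.

End InclusionExclusion.

(** * The sum over compositions as a finite difference *)

Section CompSum.
Set Implicit Arguments.
Unset Strict Implicit.
Context {d : measure_display} {T : measurableType d} {R : realType}.
Variable P : probability T R.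
Variable mu : nat -> R.
Variable X : nat -> T -> R.
Hypothesis iX : iid_moments P mu X.

(* The sequence listing [A], then its complement in [0, k), then the
   integers from [k] on. *)
Lemma exists_reindexing (k : nat) (A : {set 'I_k}) :
  exists2 s : nat -> nat, injective s &
    forall v : nat -> R, \sum_(p < k) v (s p) = \sum_(p < k) v p /\
      \sum_(p < #|A|) v (s p) = \sum_(p in A) v p.
Proof.
pose t := map val (enum A) ++ map val (enum (~: A)).
have t_perm : perm_eq t (iota 0 k).
  rewrite -val_enum_ord /t -map_cat; apply: perm_map; apply: uniq_perm.
  - rewrite cat_uniq !enum_uniq andbT/=; apply/hasPn => p.
    by rewrite !mem_enum inE.
  - exact: enum_uniq.
  - by move=> p; rewrite mem_cat !mem_enum !inE orbN.
have st : size t = k by rewrite (perm_size t_perm) size_iota.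
(* The default value [p] makes the map the identity from [k] on, which keeps it injective. *)
exists (fun p => nth p t p) => [p q|v].
  have tk i : (i < k)%N -> (nth i t i < k)%N.
    move=> ik; have : nth i t i \in t by rewrite mem_nth// st.
    by rewrite (perm_mem t_perm) mem_iota.
  have tn i : (k <= i)%N -> nth i t i = i by move=> ki; rewrite nth_default// st.
  have [pk|pk] := ltnP p k; have [qk|qk] := ltnP q k.
  - rewrite (set_nth_default p q) ?st// => /eqP.
    rewrite nth_uniq ?st//; first by move/eqP.
    by rewrite (perm_uniq t_perm) iota_uniq.
  - by rewrite (tn q)// => pq; move: (tk p pk); rewrite pq ltnNge qk.
  - by rewrite (tn p)// => pq; move: (tk q qk); rewrite -pq ltnNge pk.
  - by rewrite !tn.
split.
  transitivity (\sum_(i <- t) v i).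
    rewrite (big_nth 0%N) st big_mkord; apply: eq_bigr => p _.
    by rewrite (set_nth_default 0%N)// st.
  by rewrite (perm_big _ t_perm)/= -[X in iota 0 X]subn0 -/(index_iota 0 k) big_mkord.
transitivity (\sum_(i <- map val (enum A)) v i).
  rewrite (big_nth 0%N) size_map -cardE big_mkord; apply: eq_bigr => p _.
  have pA : (p < size (map val (enum A)))%N by rewrite size_map -cardE.
  by rewrite nth_cat pA (set_nth_default 0%N).
by rewrite big_map big_enum.
Qed.

Definition mixed_moment (r n m k i : nat) : R :=
  Ex P (fun w => (Ssum X k w + r%:R) ^+ n * Ssum X i w ^+ m).

Lemma polyfun_shifted_sum (r k : nat) : polyfun k (fun v => \sum_(p < k) v p + r%:R : R).
Proof. apply: polyfunD; [exact: polyfun_psum|exact: polyfun_cst]. Qed.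

(** A reindexing that brings [A] to the front leaves the sum of the first [k] variables unchanged,
    and by exchangeability the expectation too. *)
Lemma mixed_moment_subset (r n m k : nat) (A : {set 'I_k}) :
  Ex P (fun w => (Ssum X k w + r%:R) ^+ n * (\sum_(p in A) X p w) ^+ m) =
  mixed_moment r n m k #|A|.
Proof.
have [s s_inj sE] := exists_reindexing A.
pose F (v : nat -> R) := (\sum_(p < k) v p + r%:R) ^+ n * (\sum_(p < #|A|) v p) ^+ m.
have FN : polyfun k F.
  apply: polyfunM; apply: polyfunX; first exact: polyfun_shifted_sum.
  by apply: polyfun_psum; rewrite -[X in (_ <= X)%N]card_ord max_card.
rewrite -[RHS]/(Ex P (fun w => F (X ^~ w))).
rewrite (polyfun_exchangeable iX (iid_moments_comp s_inj iX) FN) /F.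
by congr Ex; apply/funext => w /=; rewrite (sE (X ^~ w)).1 (sE (X ^~ w)).2.
Qed.

(** The identity on compositions is applied pointwise under the expectation; each subset then counts
    only through its size. *)
Lemma compSum_incl_excl (r n k j : nat) :
  compSum P X r n k j =
  \sum_(i < k.+1) 'C(k, i)%:R * (-1) ^+ (k - i) * mixed_moment r n j k i.
Proof.
have pA (A : {set 'I_k}) : polyfun k (fun v => \sum_(p in A) v p : R).
  by apply: polyfun_sum => p; exact: polyfun_coord.
have pS := polyfun_shifted_sum r k.
transitivity (\sum_(A : {set 'I_k}) (-1) ^+ (k - #|A|) * mixed_moment r n j k #|A|).
  under [RHS]eq_bigr do rewrite -mixed_moment_subset.
  have Ai (A : {set 'I_k}) :
      integ P (fun w => (Ssum X k w + r%:R) ^+ n * (\sum_(p in A) X p w) ^+ j).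
    by apply: (polyfun_integ iX (polyfunM (polyfunX n pS) (polyfunX j (pA A)))).
  have li (l : {ffun 'I_k -> 'I_j.+1}) :
      integ P (fun w => (Ssum X k w + r%:R) ^+ n * \prod_(p < k) X p w ^+ l p).
    apply: (polyfun_integ (F := fun v => (\sum_(p < k) v p + r%:R) ^+ n *
      \prod_(p < k) v p ^+ l p) iX (polyfunM (polyfunX n pS) _)).
    by apply: polyfun_prod => p; apply: polyfunX; exact: polyfun_coord.
  rewrite /compSum; under [LHS]eq_bigr do rewrite -ExZ//.
  rewrite -[LHS]Ex_sum; last by move=> l _ _; exact: integZ.
  under [RHS]eq_bigr do rewrite -ExZ//.
  rewrite -[RHS]Ex_sum; last by move=> A _ _; exact: integZ.
  congr Ex; apply/funext => w.
  under [LHS]eq_bigr do rewrite mulrCA.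
  rewrite -mulr_sumr sum_compositions_incl_excl mulr_sumr.
  by apply: eq_bigr => A _; rewrite mulrCA.
(* Group the subsets by cardinality: ['C(k, i)] of them have [i] elements. *)
have Ak (A : {set 'I_k}) : (#|A| < k.+1)%N by rewrite ltnS -[X in (_ <= X)%N]card_ord max_card.
rewrite (partition_big (fun A => Ordinal (Ak A)) predT)//=.
apply: eq_bigr => i _.
rewrite (eq_bigr (fun=> (-1) ^+ (k - i) * mixed_moment r n j k i)); last first.
  by move=> A /eqP <-.
rewrite big_const iter_addr_0 -[LHS]mulr_natl mulrA; congr (_ %:R * _ * _).
have -> : 'C(k, i) = #|[set A : {set 'I_k} | #|A| == i]%SET|.
  by rewrite card_draws card_ord.
by apply: eq_card => A; rewrite !inE.
Qed.

(** A sum of [k] positive parts is at least [k], so the index set is empty. *)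
Lemma compSum_eq0 (r n k j : nat) : (j < k)%N -> compSum P X r n k j = 0.
Proof.
move=> jk; rewrite /compSum big_pred0// => l; apply/negbTE/negP => /andP[/forallP l0 /eqP lj].
have : (k <= \sum_(p < k) (l p : nat))%N.
  rewrite -[X in (X <= _)%N]card_ord -sum1_card; apply: leq_sum => p _; exact: l0.
by rewrite lj leqNgt jk.
Qed.

End CompSum.

(** * Finite differences on the diagonal and reindexing of double sums *)

Section FiniteDifferences.
Set Implicit Arguments.
Unset Strict Implicit.

Lemma expr_sub1 (A : comPzRingType) (x : A) (n : nat) :
  (x - 1) ^+ n = \sum_(i < n.+1) 'C(n, i)%:R * (-1) ^+ (n - i) * x ^+ i.
Proof.
rewrite addrC exprDn; apply: eq_bigr => i _.
by rewrite -mulr_natl mulrA.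
Qed.

(* The image of [(z * y - 1) ^ q = (z * (y - 1) + (z - 1)) ^ q] under the linear
   form on polynomials that sends [z ^ b * y ^ t] to [G b t]. *)
Lemma diag_difference_split (R : comNzRingType) (G : nat -> nat -> R) (q : nat) :
  \sum_(j < q.+1) 'C(q, j)%:R * (-1) ^+ (q - j) * G j j =
  \sum_(k < q.+1) 'C(q, k)%:R *
    \sum_(s < (q - k).+1) \sum_(t < k.+1)
      ('C(q - k, s)%:R * (-1) ^+ (q - k - s)) *
      ('C(k, t)%:R * (-1) ^+ (k - t)) * G (k + s)%N t.
Proof.
pose A := {poly {poly R}}.
(* Reading coefficients up to degree [q] suffices, since all monomials met below have degree at most
   [q] in each variable. The outer variable is [z], the inner one [y]. *)
pose L (p : A) : R := \sum_(b < q.+1) \sum_(t < q.+1) p`_b`_t * G b t.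
have Lsum (I : finType) (F : I -> A) : L (\sum_i F i) = \sum_i L (F i).
  rewrite exchange_big/=; apply: eq_bigr => b _; rewrite exchange_big/=.
  by apply: eq_bigr => t _; rewrite !coef_sum mulr_suml.
have Lmul (c : R) (p : A) : L (c%:P%:P * p) = c * L p.
  rewrite mulr_sumr; apply: eq_bigr => b _; rewrite mulr_sumr.
  by apply: eq_bigr => t _; rewrite !coefCM mulrA.
pose z : A := 'X; pose y : A := 'X%:P.
have Lmon b t : (b <= q)%N -> (t <= q)%N -> L (z ^+ b * y ^+ t) = G b t.
  rewrite -ltnS => bq; rewrite -ltnS => tq; rewrite /L (bigD1 (Ordinal bq))//= [X in _ + X]big1.
    rewrite addr0 (bigD1 (Ordinal tq))//= big1 => [|u ut].
      by rewrite addr0 /z /y -polyC_exp coefMC !coefXn !eqxx/= mul1r coefXn eqxx mul1r.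
    rewrite /z /y -polyC_exp coefMC !coefXn eqxx/= mul1r coefXn.
    by rewrite -(inj_eq val_inj)/= in ut; rewrite (negbTE ut) mul0r.
  move=> u ub; apply: big1 => v _.
  rewrite /z /y -polyC_exp coefMC !coefXn.
  by rewrite -(inj_eq val_inj)/= in ub; rewrite (negbTE ub) mul0r coef0 mul0r.
have natE n : n%:R = (n%:R : R)%:P%:P :> A by rewrite !polyC_natr.
have scal n e : n%:R * (-1) ^+ e = (n%:R * (-1) ^+ e : R)%:P%:P :> A.
  by rewrite !polyCM !polyC_exp !polyCN !polyC_natr.
transitivity (L ((z * y - 1) ^+ q)).
  rewrite expr_sub1 Lsum; apply: eq_bigr => j _.
  by rewrite scal Lmul exprMn Lmon// -ltnS.
have -> : z * y - 1 = (z - 1) + z * (y - 1) by ring.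
rewrite exprDn Lsum; apply: eq_bigr => k _.
rewrite -mulr_natl natE Lmul.
congr (_ * _).
rewrite exprMn !expr_sub1 mulr_suml Lsum; apply: eq_bigr => s _.
rewrite !mulr_sumr Lsum; apply: eq_bigr => t _.
rewrite !scal.
set c := 'C(q - k, s)%:R * _; set c' := 'C(k, t)%:R * _.
rewrite (_ : _ * _ = c%:P%:P * (c'%:P%:P * (z ^+ (k + s) * y ^+ t))); last by rewrite exprD; ring.
have kq : (k <= q)%N by rewrite -ltnS.
rewrite !Lmul mulrA Lmon//.
  by rewrite -leq_subRL// -ltnS.
by rewrite (leq_trans _ kq)// -ltnS.
Qed.

(** Only the triangle [k + l <= N] of the square contributes; it is summed along the lines
    [k + l = q]. *)
Lemma sum_square_antidiag (V : nmodType) (N : nat) (b : nat -> nat -> V) :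
  (forall k l, (N < k + l)%N -> b k l = 0) ->
  \sum_(k < N.+1) \sum_(l < N.+1) b k l = \sum_(q < N.+1) \sum_(k < q.+1) b k (q - k)%N.
Proof.
move=> b0.
under [RHS]eq_bigr do rewrite (big_ord_widen N.+1 (fun k => b k (_ - k)%N))//.
rewrite [RHS](exchange_big_dep predT)//=; apply: eq_bigr => k _.
under [RHS]eq_bigl do rewrite ltnS.
rewrite -(big_geq_mkord k N.+1 predT (fun q => b k (q - k)%N)).
rewrite -[X in \sum_(X <= _ < _) _]add0n big_addn big_mkord.
under [RHS]eq_bigr do rewrite addnK.
rewrite [RHS](big_ord_widen N.+1 (b k)) ?leq_subr// [RHS]big_mkcond/=.
apply: eq_bigr => l _; case: ifPn => //; rewrite ltn_subRL -leqNgt => kl.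
by apply: b0.
Qed.

Lemma sum_ord_extend (V : nmodType) (n N : nat) (f : nat -> V) : (n <= N)%N ->
  (forall l, (n < l)%N -> f l = 0) -> \sum_(l < n.+1) f l = \sum_(l < N.+1) f l.
Proof.
move=> nN f0; rewrite (big_ord_widen N.+1 f)// big_mkcond/=.
by apply: eq_bigr => l _; case: ifPn => //; rewrite -leqNgt => /f0.
Qed.

End FiniteDifferences.

(** * The Spivey-type formula for variables with common moments *)

Section SpiveyFormula.
Set Implicit Arguments.
Unset Strict Implicit.
Context {d : measure_display} {T : measurableType d} {R : realType}.
Variable P : probability T R.
Variable mu : nat -> R.
Variable X : nat -> T -> R.
Hypothesis iX : iid_moments P mu X.

(** The two-index function [G(b, i)]; in contrast to [mixed_moment], both sums carry the shift
    [r]. *)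
Definition shifted_moment (r n m b i : nat) : R :=
  Ex P (fun w => (Ssum X b w + r%:R) ^+ n * (Ssum X i w + r%:R) ^+ m).

Lemma polyfun_shifted_sumX (r n N k : nat) : (k <= N)%N ->
  polyfun N (fun v => (\sum_(p < k) v p + r%:R : R) ^+ n).
Proof.
move=> kN; apply: polyfunX; apply: polyfunD; last exact: polyfun_cst.
exact: polyfun_psum.
Qed.

(** Binomial expansion of the second shifted power, the source of the factors ['C(m, j)] and
    [r ^+ (m - j)]. *)
Lemma shifted_momentE (r n m k t : nat) : (t <= k)%N ->
  shifted_moment r n m k t =
  \sum_(j < m.+1) 'C(m, j)%:R * mixed_moment P X r n j k t * r%:R ^+ (m - j).
Proof.
move=> tk.
have ji j : integ P (fun w => (Ssum X k w + r%:R) ^+ n * Ssum X t w ^+ j).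
  exact: (polyfun_integ iX (polyfunM (polyfun_shifted_sumX r n (leqnn k))
    (polyfunX j (polyfun_psum tk)))).
under [RHS]eq_bigr do rewrite mulrAC -ExZ//.
rewrite -[RHS]Ex_sum; last by move=> j _ _; exact: integZ.
congr Ex; apply/funext => w; rewrite [Ssum X t w + _]addrC [(_ + Ssum X t w) ^+ m]exprDn mulr_sumr.
by apply: eq_bigr => j _; rewrite -mulr_natl; ring.
Qed.

(** The terms with [j < k] vanish, so the sum extends to all [j <= m]; after inclusion-exclusion,
    summing over [j] first restores the shift in the second factor. *)
Lemma compSum_shifted (r e m k : nat) :
  \sum_(k <= j < m.+1) 'C(m, j)%:R * compSum P X r e k j * r%:R ^+ (m - j) =
  \sum_(t < k.+1) 'C(k, t)%:R * (-1) ^+ (k - t) * shifted_moment r e m k t.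
Proof.
rewrite (big_geq_mkord k m.+1 predT) big_mkcond/=.
transitivity (\sum_(j < m.+1) 'C(m, j)%:R * compSum P X r e k j * r%:R ^+ (m - j)).
  apply: eq_bigr => j _; case: ifPn => //; rewrite -ltnNge => jk.
  by rewrite compSum_eq0// mulr0 mul0r.
under [LHS]eq_bigr do rewrite (compSum_incl_excl iX) mulr_sumr mulr_suml.
rewrite exchange_big/=; apply: eq_bigr => t _.
rewrite shifted_momentE -1?ltnS// mulr_sumr; apply: eq_bigr => j _.
by ring.
Qed.

(** The binomial theorem is applied to the first [k] variables, with the shift, plus the next [s].
    As [t <= k], the new block is independent of both other sums, and its sum has the moments of
    [Ssum X s]. *)
Lemma shifted_moment_convolution (r n m k s t : nat) : (t <= k)%N ->
  \sum_(i < n.+1) 'C(n, i)%:R * Ex P (fun w => Ssum X s w ^+ i) *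
    shifted_moment r (n - i) m k t = shifted_moment r n m (k + s) t.
Proof.
move=> tk.
pose F e (v : nat -> R) := (\sum_(p < k) v p + r%:R) ^+ e * (\sum_(p < t) v p + r%:R) ^+ m.
pose G i (v : nat -> R) := (\sum_(p < s) v p) ^+ i.
have FN N e : (k <= N)%N -> polyfun N (F e).
  move=> kN; apply: polyfunM; apply: polyfun_shifted_sumX => //.
  exact: leq_trans kN.
have GN i : polyfun s (G i) by apply: polyfunX; exact: polyfun_psum.
have FGi e i : integ P (fun w => F e (X ^~ w) * G i (fun p => X (k + p)%N w)).
  apply: (polyfun_integ (F := fun v => F e v * G i (fun p => v (k + p)%N)) iX).
  apply: (@polyfunM _ (k + s)); first exact: FN (leq_addr _ _).
  apply: polyfunX; apply: polyfun_sum => p; apply: polyfun_coord.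
  by rewrite ltn_add2l.
transitivity (\sum_(i < n.+1) 'C(n, i)%:R *
    Ex P (fun w => F (n - i)%N (X ^~ w) * G i (fun p => X (k + p)%N w))).
  apply: eq_bigr => i _.
  by rewrite (polyfun_indep iX (FN k _ (leqnn k)) (GN i)) -mulrA [_ * shifted_moment _ _ _ _ _]mulrC.
under eq_bigr do rewrite -ExZ//.
rewrite -Ex_sum; last by move=> i _ _; exact: integZ.
congr Ex; apply/funext => w.
have -> : Ssum X (k + s) w + r%:R = (Ssum X k w + r%:R) + \sum_(p < s) X (k + p)%N w.
  by rewrite /Ssum big_split_ord/= addrAC.
rewrite exprDn mulr_suml; apply: eq_bigr => i _.
by rewrite /F /G -/(Ssum X k w) -/(Ssum X t w) -mulr_natl; ring.
Qed.

(** With exponent [0] on the shifted sum, inclusion-exclusion identifies [l!] times this number with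
    a sum over compositions of [n] into [l] positive parts, of which there are none. *)
Lemma stirY_eq0 (n l : nat) : (n < l)%N -> stirY P X n l = 0.
Proof.
move=> nl; rewrite -[RHS](mulr0 (l`!%:R)^-1) -(compSum_eq0 P X 0 0 nl).
rewrite (compSum_incl_excl iX); congr (_ * _); apply: eq_bigr => i _.
by congr (_ * Ex P _); apply/funext => w; rewrite expr0 mul1r.
Qed.

Lemma phirY_spivey (r m n : nat) (x : R) :
  phirY P X r (m + n) x =
  \sum_(i < n.+1) \sum_(k < m.+1)
     'C(n, i)%:R * x ^+ k * phiY P X i x *
     ((k`!%:R)^-1 *
      \sum_(k <= j < m.+1)
        'C(m, j)%:R * compSum P X r (n - i) k j * r%:R ^+ (m - j)).
Proof.
pose inn i k := \sum_(t < k.+1) 'C(k, t)%:R * (-1) ^+ (k - t) * shifted_moment r (n - i) m k t.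
(* Coefficient of [x ^+ k * x ^+ l] on the right-hand side, where [x ^+ l] comes from [phiY]. *)
pose a k l := \sum_(i < n.+1) 'C(n, i)%:R * stirY P X i l * ((k`!%:R)^-1 * inn i k).
have inn0 i k : (m < k)%N -> inn i k = 0.
  by move=> mk; rewrite /inn -compSum_shifted big_geq.
(* Beyond total degree [m + n], either [k] exceeds [m] or [l] exceeds [n]. *)
have a0 k l : (m + n < k + l)%N -> a k l * (x ^+ k * x ^+ l) = 0.
  move=> mnkl; rewrite /a big1 ?mul0r// => i _.
  have [mk|km] := ltnP m k; first by rewrite inn0// !mulr0.
  rewrite stirY_eq0 ?mulr0 ?mul0r// (leq_trans (ltn_ord i))//.
  by rewrite ltnNge; apply/negP => ln; move: mnkl; rewrite ltnNge leq_add.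
(* Summing over [i] by convolution turns [a k l] into an iterated difference of [shifted_moment]. *)
have aE k l : a k l = (k`!%:R)^-1 * (l`!%:R)^-1 *
    \sum_(s < l.+1) \sum_(t < k.+1) ('C(l, s)%:R * (-1) ^+ (l - s)) *
      ('C(k, t)%:R * (-1) ^+ (k - t)) * shifted_moment r n m (k + s) t.
  transitivity (\sum_(i < n.+1) \sum_(s < l.+1) \sum_(t < k.+1)
      (k`!%:R)^-1 * (l`!%:R)^-1 * (('C(l, s)%:R * (-1) ^+ (l - s)) *
      ('C(k, t)%:R * (-1) ^+ (k - t)) * ('C(n, i)%:R *
      Ex P (fun w => Ssum X s w ^+ i) * shifted_moment r (n - i) m k t))).
    apply: eq_bigr => i _; rewrite /stirY /inn mulrA !mulr_sumr [RHS]exchange_big/=.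
    apply: eq_bigr => t _; rewrite !mulr_suml; apply: eq_bigr => s _.
    by ring.
  rewrite exchange_big/= mulr_sumr; apply: eq_bigr => s _.
  rewrite exchange_big/= mulr_sumr; apply: eq_bigr => t _.
  by rewrite -!mulr_sumr shifted_moment_convolution// -ltnS.
transitivity (\sum_(k < (m + n).+1) \sum_(l < (m + n).+1) a k l * (x ^+ k * x ^+ l)).
  rewrite (sum_square_antidiag a0); apply: eq_bigr => q _.
  (* The moment of order [m + n] is the diagonal value [G(j, j)]. After the difference is split,
     ['C(q, k) / q!] equals [1 / (k! (q - k)!)]. *)
  rewrite /rstirY (eq_bigr (fun j : 'I_q.+1 =>
    'C(q, j)%:R * (-1) ^+ (q - j) * shifted_moment r n m j j)); last first.
    move=> j _; congr (_ * Ex P _); apply/funext => w.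
    by rewrite exprD mulrC.
  rewrite diag_difference_split mulr_sumr mulr_suml; apply: eq_bigr => k _.
  have kq : (k <= q)%N by rewrite -ltnS.
  rewrite aE -exprD subnKC// !mulrA; congr (_ * _ * _).
  rewrite -(bin_fact kq) !natrM.
  have f0 i : i`!%:R != 0 :> R by rewrite pnatr_eq0 -lt0n fact_gt0.
  have b0 : 'C(q, k)%:R != 0 :> R by rewrite pnatr_eq0 -lt0n bin_gt0.
  by field; rewrite b0 !f0.
(* Enlarging the ranges of [l] and [k] to [m + n] adds only zero terms and makes them independent of
   [i]. *)
have phiE i : (i <= n)%N -> phiY P X i x = \sum_(l < (m + n).+1) stirY P X i l * x ^+ l.
  move=> ni; rewrite /phiY (@sum_ord_extend _ i (m + n) (fun l => stirY P X i l * x ^+ l))//.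
    by rewrite (leq_trans ni)// leq_addl.
  by move=> l il; rewrite stirY_eq0// mul0r.
under [RHS]eq_bigr => i _.
  under eq_bigr do rewrite compSum_shifted -/(inn i _).
  rewrite (@sum_ord_extend _ m (m + n) (fun k => 'C(n, i)%:R * x ^+ k * phiY P X i x *
    ((k`!%:R)^-1 * inn i k))) ?leq_addr//; last first.
    by move=> l ml; rewrite inn0// !mulr0.
  over.
rewrite [RHS]exchange_big/=; apply: eq_bigr => k _.
under [RHS]eq_bigr => i _.
  rewrite phiE -1?ltnS// mulr_sumr mulr_suml.
  over.
rewrite [RHS]exchange_big/=; apply: eq_bigr => l _.
rewrite /a mulr_suml; apply: eq_bigr => i _.
by ring.
Qed.

End SpiveyFormula.

Theorem theorem2p7 (d : measure_display) (T : measurableType d) (R : realType)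
  (P : probability T R) (Y : {RV P >-> R}) (X : nat -> {RV P >-> R})
  (hmgf : mgf_exists P Y)
  (hind : mutually_independent P (fun j => (X j : T -> R)))
  (hdist : forall j, same_distribution P (X j) Y)
  (r : nat) (hr : (0 < r)%N) (m n : nat) (x : R) :
  phirY P (fun j => (X j : T -> R)) r (m + n) x =
  \sum_(i < n.+1) \sum_(k < m.+1)
     'C(n, i)%:R * x ^+ k * phiY P (fun j => (X j : T -> R)) i x *
     ((k`!%:R)^-1 *
      \sum_(k <= j < m.+1)
        'C(m, j)%:R * compSum P (fun j => (X j : T -> R)) r (n - i) k j
        * r%:R ^+ (m - j)).
Proof.
have mX j : measurable_fun setT (X j : T -> R) by [].
have Ymom a := mgf_exists_moment a (measurable_funPT Y) hmgf.
(* The common moments [mu] are those of [Y]. *)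
apply: (@phirY_spivey _ _ _ P (fun a => Ex P (fun w => Y w ^+ a))).
split => // j a; apply: (same_distribution_Ex (f := fun y => y ^+ a) (hdist j)) => //.
Qed.
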